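(* Let $S$ be an ordered semigroup. Then the following conditions are equivalent: (1) $S$ is a left $\pi$-$t$-simple ordered semigroup; (2) $S$ is $\pi$-regular and contains an $\mathcal{L}^*$-unique ordered idempotent; (3) $S$ is $\pi$-regular and $a\,\mathcal{L}^*\,b$ for every $a,b\in S$; (4) for every $a,b\in S$ there exists $m\in\mathbb{N}$ such that $a^m\in(a^mSb]$; (5) for every $a,b\in S$ there exists $m\in\mathbb{N}$ such that $a^m\in(a^mSb^n]$ for every $n\in\mathbb{N}$; (6) for every $a,b\in S$ there exists $m\in\mathbb{N}$ such that $a^m\in(a^mSb^m]$; (7) $S$ is $\pi$-regular and $l$-Archimedean; (8) $S$ is a nil-extension of a left simple $\pi$-regular ordered semigroup.
   Context: An ordered semigroup $(S,\cdot,\leq)$ is a (nonempty) semigroup with a partial order such that $a\leq b$ implies $xa\leq xb$ and $ax\leq bx$ for all $a,b,x\in S$. $\mathbb{N}$ denotes the positive integers. For $A\subseteq S$, $(A]=\{x\in S: x\leq a \text{ for some } a\in A\}$. A subsemigroup is regarded as an ordered semigroup with the restricted order. A nonempty $A\subseteq S$ is a left ideal if $SA\subseteq A$ and $(A]=A$, a right ideal if $AS\subseteq A$ and $(A]=A$, and an ideal if it is both. $S$ is left simple if it has no proper left ideal (equivalently $S=(Sa]$ for all $a\in S$). $S$ is $\pi$-regular if for every $a\in S$ there is $m\in\mathbb{N}$ with $a^m\in(a^mSa^m]$. $S$ is $l$-Archimedean (left Archimedean) if for all $a,b\in S$ there is $n\in\mathbb{N}$ with $a^n\in(Sb]$. $S$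 is left $\pi$-$t$-simple if there is a subsemigroup $H$ of $S$ which, as an ordered semigroup, is left simple and $\pi$-regular, such that for every $a\in S$ there is $m\in\mathbb{N}$ with $a^m\in H$. $S$ is a nil-extension of $K$ if $K$ is an ideal of $S$ and for every $a\in S$ there is $m\in\mathbb{N}$ with $a^m\in K$. $L(a)=(\{a\}\cup Sa]$, and $a\,\mathcal{L}\,b$ iff $L(a)=L(b)$. $Reg_\leq(S)=\{a\in S: a\in(aSa]\}$. For $S$ $\pi$-regular, $a\,\mathcal{L}^*\,b$ iff $a^m\,\mathcal{L}\,b^n$, where $m,n$ are the smallest positive integers such that $a^m,b^n\in Reg_\leq(S)$. $E_\leq(S)=\{e\in S: e\leq e^2\}$ is the set of ordered idempotents. $S$ contains an $\mathcal{L}^*$-unique ordered idempotent if there is $e\in E_\leq(S)$ such that $e\,\mathcal{L}^*\,f$ for every $f\in E_\leq(S)$. *)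

(* Defs.v *)
From HB Require Import structures.
From mathcomp Require Import all_boot all_order.
From mathcomp Require Import boolp classical_sets.

Set Implicit Arguments.
Unset Strict Implicit.
Unset Printing Implicit Defensive.

Local Open Scope classical_set_scope.
Local Open Scope group_scope.

HB.mixin Record isOrderedSemigroup (d : Order.disp_t) S
    of Semigroup S & Order.POrder d S := {
  osg_nonempty : inhabited S;
  osg_leM2l : forall x a b : S, (a <= b)%O -> (x * a <= x * b)%O;
  osg_leM2r : forall x a b : S, (a <= b)%O -> (a * x <= b * x)%O
}.

#[short(type="orderedSemigroupType")]
HB.structure Definition OrderedSemigroup (d : Order.disp_t) :=
  { S of isOrderedSemigroup d S & Semigroup S & Order.POrder d S }.

(* The library power natexp needs a unit. This is the product of n copies of
   a when 0 < n; the junk value at n = 0 is a, so every use below carries the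
   hypothesis 0 < n. *)
Definition spow (d : Order.disp_t) (S : orderedSemigroupType d) (a : S)
  (n : nat) : S := iterop n (fun x y : S => x * y) a a.

Notation "a ^^ n" := (spow a n) (at level 29, left associativity).

Record subsemigroup (d : Order.disp_t) (S : orderedSemigroupType d) :=
  Subsemigroup {
    subsg_set :> set S;
    subsg_nonempty : subsg_set !=set0;
    subsg_mul : forall x y, subsg_set x -> subsg_set y -> subsg_set (x * y)
  }.

Section SubOrderedSemigroup.
Context (d : Order.disp_t) (S : orderedSemigroupType d) (H : subsemigroup S).

Definition subsg_type : Type := {x : S | x \in subsg_set H}.

HB.instance Definition _ := SubChoice.on subsg_type.
HB.instance Definition _ :=
  Order.SubChoice_isSubPOrder.Build d S (fun x => x \in subsg_set H) d
    subsg_type.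

Fact subsg_mul_subproof (x y : subsg_type) : val x * val y \in subsg_set H.
Proof. by apply/mem_set/subsg_mul; apply/set_mem/valP. Qed.

Definition subsg_op (x y : subsg_type) : subsg_type :=
  exist _ (val x * val y) (subsg_mul_subproof x y).

Fact subsg_opA : associative subsg_op.
Proof. by move=> x y z; apply/val_inj; rewrite /= mulgA. Qed.

HB.instance Definition _ := isSemigroup.Build subsg_type subsg_opA.

Fact subsg_inhabited : inhabited subsg_type.
Proof. by have [x Hx] := subsg_nonempty H; split; exists x; apply/mem_set. Qed.

Fact subsg_leM2l (x a b : subsg_type) : (a <= b)%O -> (x * a <= x * b)%O.
Proof. exact: osg_leM2l. Qed.

Fact subsg_leM2r (x a b : subsg_type) : (a <= b)%O -> (a * x <= b * x)%O.
Proof. exact: osg_leM2r. Qed.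

HB.instance Definition _ := isOrderedSemigroup.Build d subsg_type
  subsg_inhabited subsg_leM2l subsg_leM2r.

Definition subsg_osg : orderedSemigroupType d := subsg_type.
End SubOrderedSemigroup.

Section Definitions.
Context (d : Order.disp_t) (S : orderedSemigroupType d).
Implicit Types (a b : S) (A : set S).

(* (A] *)
Definition downset A : set S := [set x | exists2 a, A a & (x <= a)%O].

Definition left_ideal A :=
  [/\ A !=set0, [set s * a | s in setT & a in A] `<=` A & downset A = A].

Definition right_ideal A :=
  [/\ A !=set0, [set a * s | a in A & s in setT] `<=` A & downset A = A].

Definition ideal A := left_ideal A /\ right_ideal A.

Definition left_simple := forall A, left_ideal A -> A = setT.

Definition pi_regular := forall a, exists2 m, (0 < m)%N &
  downset [set a ^^ m * s * a ^^ m | s in setT] (a ^^ m).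

Definition l_archimedean := forall a b, exists2 n, (0 < n)%N &
  downset [set s * b | s in setT] (a ^^ n).

(* L(a) *)
Definition lideal_gen a : set S := downset ([set a] `|` [set s * a | s in setT]).

Definition Lrel a b := lideal_gen a = lideal_gen b.

Definition Reg : set S := [set a | downset [set a * s * a | s in setT] a].

Definition regular_index a m :=
  [/\ (0 < m)%N, Reg (a ^^ m)
    & forall k, (0 < k)%N -> Reg (a ^^ k) -> (m <= k)%N].

(* Meant for pi-regular S only, where the indices m and n exist; they are
   always unique. *)
Definition Lstar a b := exists m n,
  [/\ regular_index a m, regular_index b n & Lrel (a ^^ m) (b ^^ n)].

Definition ordered_idempotent : set S := [set e | (e <= e * e)%O].

Definition has_Lstar_unique_ordered_idempotent :=
  exists2 e, ordered_idempotent e &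
    forall f, ordered_idempotent f -> Lstar e f.

Definition nil_extension A :=
  ideal A /\ forall a, exists2 m, (0 < m)%N & A (a ^^ m).

End Definitions.

Arguments left_simple {d} S.
Arguments pi_regular {d} S.
Arguments l_archimedean {d} S.
Arguments has_Lstar_unique_ordered_idempotent {d} S.

Definition left_pi_t_simple (d : Order.disp_t) (S : orderedSemigroupType d) :=
  exists H : subsemigroup S,
    [/\ left_simple (subsg_osg H), pi_regular (subsg_osg H)
      & forall a : S, exists2 m, (0 < m)%N & subsg_set H (a ^^ m)].

(* Main.v *)
(** If [S] is l-Archimedean, then [x <= x * (s * b)] gives
    [x <= x * (s * b) ^^ n] for all [n > 0], while some power of [s * b] lies in
    (Sy]; so membership of [x] in (xSb] for a single [b] implies membership in
    (xSy] for every [y]. Hence a regular element lies in all the (Sy], and any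
    two regular elements are L-related. The kernel in (8) is the intersection of
    the (Sy]: it contains every regular element, and it is a right ideal
    because, for [x] in it and any [s], one may write [x <= t * y] with [y] a
    power of [s] lying in it, so that [x * s <= t * (s * y)]. *)

Require Import Defs.
From mathcomp Require Import all_boot all_order.
From mathcomp Require Import boolp classical_sets.

Set Implicit Arguments.
Unset Strict Implicit.
Unset Printing Implicit Defensive.

Import Order.POrderTheory.

Local Open Scope classical_set_scope.
Local Open Scope group_scope.

Section Powers.
Context {d : Order.disp_t} {S : orderedSemigroupType d}.
Implicit Types (a c e x : S) (m n : nat) (A B : set S).

Lemma spowS a n : (0 < n)%N -> a ^^ n.+1 = a * a ^^ n.
Proof. by case: n. Qed.

Lemma spowD a m n : (0 < m)%N -> (0 < n)%N -> a ^^ (m + n) = a ^^ m * a ^^ n.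
Proof.
case: m => // m _ n_gt0; elim: m => [|m IHm]; first by rewrite add1n spowS.
by rewrite addSn spowS // IHm [in RHS]spowS // mulgA.
Qed.

Lemma spowSr a n : (0 < n)%N -> a ^^ n.+1 = a ^^ n * a.
Proof. by move=> n_gt0; rewrite -addn1 spowD. Qed.

Lemma spowM a m n : (0 < m)%N -> (0 < n)%N -> a ^^ (m * n) = a ^^ m ^^ n.
Proof.
move=> m_gt0; case: n => // n _; elim: n => [|n IHn]; first by rewrite muln1.
by rewrite mulnS spowD ?muln_gt0 ?m_gt0 // IHn [in RHS]spowS.
Qed.

Lemma le_mulr_spow x c n : (0 < n)%N -> (x <= x * c)%O -> (x <= x * c ^^ n)%O.
Proof.
case: n => // n _ le_x; elim: n => // n IHn.
by rewrite spowS // mulgA; apply: le_trans IHn (osg_leM2r _ _ _ le_x).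
Qed.

Definition power_absorbing A := forall a, exists2 m, (0 < m)%N & A (a ^^ m).

Lemma power_absorbing_sub A B :
  A `<=` B -> power_absorbing A -> power_absorbing B.
Proof. by move=> AB powA a; have [m m_gt0 /AB] := powA a; exists m. Qed.

Lemma power_absorbing_nonempty A : power_absorbing A -> A !=set0.
Proof.
by have [a] := @osg_nonempty _ S => /(_ a)[m _ Aam]; exists (a ^^ m).
Qed.

Lemma pi_regular_Reg : pi_regular S -> power_absorbing (@Reg d S).
Proof. by []. Qed.

End Powers.

Section Ideals.
Context {d : Order.disp_t} {S : orderedSemigroupType d}.
Implicit Types (a b s x y : S) (A : set S).

Lemma downset_idP A :
  downset A = A <-> forall x y, (x <= y)%O -> A y -> A x.
Proof.
split=> [<- x y le_xy [a Aa le_ya]|downA].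
  by exists a => //; apply: le_trans le_ya.
apply/seteqP; split=> [x [y Ay le_xy]|x Ax]; last by exists x.
exact: downA Ay.
Qed.

Lemma left_idealP A : left_ideal A <->
  [/\ A !=set0, forall s a, A a -> A (s * a)
    & forall x y, (x <= y)%O -> A y -> A x].
Proof.
split=> [[A0 SA /downset_idP downA]|[A0 SA downA]]; split=> //.
- by move=> s a Aa; apply: SA; exists s => //; exists a.
- by move=> _ [s _ [a Aa <-]]; apply: SA.
- exact/downset_idP.
Qed.

Lemma left_ideal_nonempty A : left_ideal A -> A !=set0.
Proof. by case. Qed.

Lemma left_ideal_mull A s a : left_ideal A -> A a -> A (s * a).
Proof. by move=> /left_idealP[_ SA _]; apply: SA. Qed.

Lemma left_ideal_le A x y : left_ideal A -> (x <= y)%O -> A y -> A x.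
Proof. by move=> /left_idealP[_ _ downA]; apply: downA. Qed.

Lemma right_idealP A : right_ideal A <->
  [/\ A !=set0, forall s a, A a -> A (a * s)
    & forall x y, (x <= y)%O -> A y -> A x].
Proof.
split=> [[A0 AS /downset_idP downA]|[A0 AS downA]]; split=> //.
- by move=> s a Aa; apply: AS; exists a => //; exists s.
- by move=> _ [a Aa [s _ <-]]; apply: AS.
- exact/downset_idP.
Qed.

Definition left_multiples b : set S := downset [set s * b | s in setT].

Lemma left_multiplesP b x : left_multiples b x <-> exists s, (x <= s * b)%O.
Proof.
split=> [[_ [s _ <-] le_x]|[s le_x]]; first by exists s.
by exists (s * b) => //; exists s.
Qed.

Lemma left_multiples_left_ideal b : left_ideal (left_multiples b).
Proof.
apply/left_idealP; split=> [|s x|x y le_xy] /=.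
- by exists (b * b); apply/left_multiplesP; exists b.
- case/left_multiplesP=> t le_x; apply/left_multiplesP; exists (s * t).
  by rewrite -mulgA; apply: osg_leM2l.
- case/left_multiplesP=> s le_y; apply/left_multiplesP; exists s.
  exact: le_trans le_y.
Qed.

Lemma left_ideal_left_multiples A a :
  left_ideal A -> A a -> left_multiples a `<=` A.
Proof.
move=> idA Aa x /left_multiplesP[s le_x].
exact: left_ideal_le idA le_x (left_ideal_mull s idA Aa).
Qed.

Lemma left_multiples_spow b n :
  (0 < n)%N -> left_multiples (b ^^ n) `<=` left_multiples b.
Proof.
case: n => [//|[|n]] _; first exact: subset_refl.
apply: left_ideal_left_multiples.
  exact: left_multiples_left_ideal.
by apply/left_multiplesP; exists (b ^^ n.+1); rewrite -spowSr.
Qed.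

Lemma left_simpleP : left_simple S <-> forall a b, left_multiples b a.
Proof.
split=> [simpleS a b|mulS A idA].
  by rewrite (simpleS _ (left_multiples_left_ideal b)).
have [a Aa] := left_ideal_nonempty idA; apply/seteqP; split=> // x _.
exact: left_ideal_left_multiples idA Aa _ (mulS x a).
Qed.

Definition sandwich a b : set S := downset [set a * s * b | s in setT].

Lemma sandwichP a b x : sandwich a b x <-> exists s, (x <= a * (s * b))%O.
Proof.
split=> [[_ [s _ <-] le_x]|[s le_x]]; first by exists s; rewrite mulgA.
by exists (a * s * b); [exists s | rewrite -mulgA].
Qed.

Lemma le_mul_sandwich a b x y :
  (x <= a * y)%O -> left_multiples b y -> sandwich a b x.
Proof.
move=> le_x /left_multiplesP[s le_y]; apply/sandwichP; exists s.
exact: le_trans le_x (osg_leM2l _ _ _ le_y).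
Qed.

Lemma sandwich_left_multiples a b : sandwich a b `<=` left_multiples b.
Proof.
move=> x /sandwichP[s le_x]; apply/left_multiplesP.
by exists (a * s); rewrite -mulgA.
Qed.

Lemma sandwich_spow a b n :
  (0 < n)%N -> sandwich a (b ^^ n) `<=` sandwich a b.
Proof.
move=> n_gt0 x /sandwichP[s le_x]; apply: le_mul_sandwich le_x _.
by apply: left_multiples_spow n_gt0 _ _; apply/left_multiplesP; exists s.
Qed.

End Ideals.

Section GreenL.
Context {d : Order.disp_t} {S : orderedSemigroupType d}.
Implicit Types (a b e s x : S) (A : set S).

Lemma lideal_genP a x :
  lideal_gen a x <-> (x <= a)%O \/ left_multiples a x.
Proof.
split=> [[y [->|Say] le_x]|[le_x|[y Say le_x]]].
- by left.
- by right; exists y.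
- by exists a => //; left.
- by exists y => //; right.
Qed.

Lemma mul_lideal_gen a s x : lideal_gen a x -> left_multiples a (s * x).
Proof.
case/lideal_genP=> [le_x|ax].
  by apply/left_multiplesP; exists s; apply: osg_leM2l.
exact: left_ideal_mull (left_multiples_left_ideal a) ax.
Qed.

Lemma lideal_gen_left_ideal a : left_ideal (lideal_gen a).
Proof.
apply/left_idealP; split=> [|s x ax|x y le_xy [z az le_yz]].
- by exists a; apply/lideal_genP; left.
- by apply/lideal_genP; right; apply: mul_lideal_gen.
- by exists z => //; apply: le_trans le_yz.
Qed.

Lemma lideal_gen_min A a : left_ideal A -> A a -> lideal_gen a `<=` A.
Proof.
move=> idA Aa x /lideal_genP[le_x|].
  exact: left_ideal_le idA le_x Aa.
exact: left_ideal_left_multiples.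
Qed.

Lemma LrelP a b : Lrel a b <-> lideal_gen b a /\ lideal_gen a b.
Proof.
have gen x : lideal_gen x x by apply/lideal_genP; left.
split=> [Lab|[ba ab]]; first by split; [rewrite -Lab | rewrite Lab].
by apply/seteqP; split; apply: lideal_gen_min => //;
  apply: lideal_gen_left_ideal.
Qed.

Lemma left_multiples_Lrel a b :
  left_multiples b a -> left_multiples a b -> Lrel a b.
Proof. by move=> ba ab; apply/LrelP; split; apply/lideal_genP; right. Qed.

Lemma Reg_sandwich a b : Reg a -> lideal_gen b a -> sandwich a b a.
Proof.
case/sandwichP=> s le_a /(mul_lideal_gen s); exact: le_mul_sandwich.
Qed.

Lemma ordered_idempotent_Reg e : ordered_idempotent e -> Reg e.
Proof.
move=> le_e; apply/sandwichP; exists e.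
exact: le_trans le_e (osg_leM2l _ _ _ le_e).
Qed.

Lemma Reg_Lrel_ordered_idempotent a :
  Reg a -> exists2 e, ordered_idempotent e & Lrel a e.
Proof.
case/sandwichP=> s le_a; exists (s * a).
  by have := osg_leM2l s _ _ le_a; rewrite /ordered_idempotent /= !mulgA.
by apply: left_multiples_Lrel; apply/left_multiplesP; [exists a | exists s].
Qed.

Lemma regular_index_uniq a m n :
  regular_index a m -> regular_index a n -> m = n.
Proof.
move=> [m_gt0 am mmin] [n_gt0 an nmin].
by apply/eqP; rewrite eqn_leq mmin ?nmin.
Qed.

Lemma Reg_regular_index a : Reg a -> regular_index a 1.
Proof. by []. Qed.

Lemma pi_regular_index a : pi_regular S -> exists m, regular_index a m.
Proof.
move=> /pi_regular_Reg/(_ a)[m m_gt0 am].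
have exP : exists n, (0 < n)%N && `[< Reg (a ^^ n) >].
  by exists m; rewrite m_gt0; apply/asboolP.
case: (ex_minnP exP) => n /andP[n_gt0 /asboolP an] nmin.
by exists n; split=> // k k_gt0 ak; apply: nmin; rewrite k_gt0; apply/asboolP.
Qed.

Lemma Reg_LstarE a b : Reg a -> Reg b -> Lstar a b <-> Lrel a b.
Proof.
move=> /Reg_regular_index a1 /Reg_regular_index b1.
split=> [[m [n [am bn]]]|Lab]; last by exists 1%N, 1%N.
by rewrite (regular_index_uniq am a1) (regular_index_uniq bn b1).
Qed.

Lemma Reg_Lrel_Lstar : pi_regular S ->
  (forall a b, Reg a -> Reg b -> Lrel a b) -> forall a b, Lstar a b.
Proof.
move=> regS RegL a b.
have [m am] := pi_regular_index a regS; have [n bn] := pi_regular_index b regS.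
have [_ Ram _] := am; have [_ Rbn _] := bn.
by exists m, n; split=> //; apply: RegL.
Qed.

Lemma Lstar_sandwich a b :
  Lstar a b -> exists2 m, (0 < m)%N & sandwich (a ^^ m) b (a ^^ m).
Proof.
move=> [m [n [[m_gt0 Ram _] [n_gt0 _ _] /LrelP[bna _]]]]; exists m => //.
exact: sandwich_spow n_gt0 _ (Reg_sandwich Ram bna).
Qed.

Lemma Lstar_has_Lstar_unique_ordered_idempotent :
  pi_regular S -> (forall a b, Lstar a b) ->
  has_Lstar_unique_ordered_idempotent S.
Proof.
move=> /pi_regular_Reg/power_absorbing_nonempty[a Ra] LS.
by have [e ide _] := Reg_Lrel_ordered_idempotent Ra; exists e.
Qed.

Lemma has_Lstar_unique_ordered_idempotent_Lstar :
  pi_regular S -> has_Lstar_unique_ordered_idempotent S ->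
  forall a b, Lstar a b.
Proof.
move=> regS [e ide uniq_e]; apply: Reg_Lrel_Lstar => //.
have RegLe c : Reg c -> Lrel c e.
  case/Reg_Lrel_ordered_idempotent=> f idf Lcf.
  have Lef : Lrel e f.
    by apply/Reg_LstarE; [exact: ordered_idempotent_Reg..|exact: uniq_e].
  by rewrite /Lrel Lcf Lef.
by move=> a b /RegLe La /RegLe Lb; rewrite /Lrel La Lb.
Qed.

End GreenL.

Section Archimedean.
Context {d : Order.disp_t} {S : orderedSemigroupType d}.
Implicit Types (a b x y : S).

Lemma sandwich_l_archimedean :
  (forall a b, exists2 m, (0 < m)%N & sandwich (a ^^ m) b (a ^^ m)) ->
  l_archimedean S.
Proof.
move=> powS a b; have [m m_gt0 am] := powS a b.
by exists m => //; apply: sandwich_left_multiples am.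
Qed.

Lemma l_archimedean_sandwich x b y :
  l_archimedean S -> sandwich x b x -> sandwich x y x.
Proof.
move=> archS /sandwichP[s le_x]; have [n n_gt0 ysb] := archS (s * b) y.
exact: le_mul_sandwich (le_mulr_spow n_gt0 le_x) ysb.
Qed.

Lemma l_archimedean_Reg a b : l_archimedean S -> Reg a -> left_multiples b a.
Proof.
move=> archS Ra; apply: (@sandwich_left_multiples _ _ a).
exact: l_archimedean_sandwich Ra.
Qed.

Lemma l_archimedean_Lstar :
  pi_regular S -> l_archimedean S -> forall a b, Lstar a b.
Proof.
move=> regS archS; apply: Reg_Lrel_Lstar => // a b Ra Rb.
by apply: left_multiples_Lrel; apply: l_archimedean_Reg.
Qed.

End Archimedean.

Section Subsemigroup.
Context {d : Order.disp_t} {S : orderedSemigroupType d} (H : subsemigroup S).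
Implicit Types (a b h : S).

Definition subsg_elt a (Ha : subsg_set H a) : subsg_osg H :=
  exist _ a (mem_set Ha).

Lemma subsg_valP (x : subsg_osg H) : subsg_set H (val x).
Proof. exact/set_mem/valP. Qed.

Lemma val_spow (x : subsg_osg H) n : (0 < n)%N ->
  val (x ^^ n : subsg_osg H) = (val x : S) ^^ n.
Proof.
case: n => // n _; elim: n => // n IHn.
by rewrite [RHS]spowS // -IHn spowS.
Qed.

Lemma subsg_spow a n : (0 < n)%N -> subsg_set H a -> subsg_set H (a ^^ n).
Proof.
move=> n_gt0 Ha; rewrite -[a]/(val (subsg_elt Ha)) -val_spow //.
exact: subsg_valP.
Qed.

Lemma left_simple_subsgP : left_simple (subsg_osg H) <->
  forall a b, subsg_set H a -> subsg_set H b ->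
    exists2 h, subsg_set H h & (a <= h * b)%O.
Proof.
split=> [/left_simpleP simpleH a b Ha Hb|simpleH].
  have /left_multiplesP[h le_a] := simpleH (subsg_elt Ha) (subsg_elt Hb).
  by exists (val h) => //; apply: subsg_valP.
apply/left_simpleP => a b; apply/left_multiplesP.
have [h Hh le_a] := simpleH _ _ (subsg_valP a) (subsg_valP b).
by exists (subsg_elt Hh).
Qed.

Lemma pi_regular_subsgP : pi_regular (subsg_osg H) <->
  forall a, subsg_set H a -> exists2 m, (0 < m)%N &
    exists2 h, subsg_set H h & (a ^^ m <= a ^^ m * (h * a ^^ m))%O.
Proof.
split=> [regH a Ha|regH x].
  have [m m_gt0 /sandwichP[h]] := regH (subsg_elt Ha).
  rewrite -[(_ <= _)%O]/(val _ <= val _ * (val h * val _))%O val_spow //.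
  by exists m => //; exists (val h) => //; apply: subsg_valP.
have [m m_gt0 [h Hh le_x]] := regH _ (subsg_valP x).
exists m => //; apply/sandwichP; exists (subsg_elt Hh).
by rewrite -[(_ <= _)%O]/(val _ <= val _ * (h * val _))%O val_spow.
Qed.

Lemma power_absorbing_pi_regular :
  power_absorbing H -> pi_regular (subsg_osg H) -> pi_regular S.
Proof.
move=> powH /pi_regular_subsgP regH a; have [m m_gt0 Ham] := powH a.
have [n n_gt0 [h _ le_amn]] := regH _ Ham.
exists (m * n)%N; first by rewrite muln_gt0 m_gt0.
by apply/sandwichP; exists h; rewrite spowM.
Qed.

Lemma power_absorbing_l_archimedean :
  power_absorbing H -> left_simple (subsg_osg H) -> l_archimedean S.
Proof.
move=> powH /left_simple_subsgP simpleH a b.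
have [n n_gt0 Hbn] := powH b.
apply: (power_absorbing_sub _ powH) => c Hc.
apply: left_multiples_spow n_gt0 _ _; apply/left_multiplesP.
by have [h _ le_c] := simpleH _ _ Hc Hbn; exists h.
Qed.

Lemma ideal_pi_regular :
  ideal H -> pi_regular S -> pi_regular (subsg_osg H).
Proof.
move=> [idH /right_idealP[_ HS _]] regS.
apply/pi_regular_subsgP => a Ha; have [m m_gt0 /sandwichP[s le_am]] := regS a.
exists m => //; exists (s * a ^^ m * s).
  by apply: HS; apply: left_ideal_mull idH _; apply: subsg_spow.
rewrite -!mulgA; apply: (le_trans le_am).
by do 2!apply: osg_leM2l.
Qed.

End Subsemigroup.

Section LeftKernel.
Context {d : Order.disp_t} {S : orderedSemigroupType d}.

Definition left_ideal_subsemigroup (A : set S) (idA : left_ideal A) :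
  subsemigroup S :=
  Subsemigroup (left_ideal_nonempty idA)
    (fun x y _ => left_ideal_mull (A := A) x idA).

Definition left_kernel : set S := \bigcap_b left_multiples b.

Lemma left_kernel_left_ideal : left_kernel !=set0 -> left_ideal left_kernel.
Proof.
move=> K0; apply/left_idealP; split=> // [s x Kx b _|x y le_xy Ky b _].
  by apply: left_ideal_mull (left_multiples_left_ideal b) _; apply: Kx.
by apply: left_ideal_le (left_multiples_left_ideal b) le_xy _; apply: Ky.
Qed.

Lemma left_kernel_right_ideal :
  power_absorbing left_kernel -> right_ideal left_kernel.
Proof.
move=> powK; have K0 := power_absorbing_nonempty powK.
have idK := left_kernel_left_ideal K0.
apply/right_idealP; split=> // [s x Kx|x y]; last exact: left_ideal_le.
have [m m_gt0 Ksm] := powK s.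
have /left_multiplesP[t le_x] := Kx (s ^^ m) I.
apply: (left_ideal_le idK (osg_leM2r s _ _ le_x)).
by rewrite -mulgA -spowSr // spowS //; do 2!apply: (left_ideal_mull _ idK).
Qed.

Lemma left_kernel_left_simple (idK : left_ideal left_kernel) :
  left_simple (subsg_osg (left_ideal_subsemigroup idK)).
Proof.
apply/left_simple_subsgP => a b Ka Kb.
have /left_multiplesP[s le_a] := Ka (b * b) I.
by exists (s * b); [exact: left_ideal_mull idK Kb | rewrite -mulgA].
Qed.

Lemma l_archimedean_power_absorbing_left_kernel :
  pi_regular S -> l_archimedean S -> power_absorbing left_kernel.
Proof.
move=> /pi_regular_Reg powReg archS; apply: power_absorbing_sub powReg.
by move=> a Ra b _; apply: l_archimedean_Reg.
Qed.

Lemma l_archimedean_nil_extension : pi_regular S -> l_archimedean S ->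
  exists K : subsemigroup S,
    [/\ left_simple (subsg_osg K), pi_regular (subsg_osg K)
      & nil_extension (subsg_set K)].
Proof.
move=> regS archS.
have powK := l_archimedean_power_absorbing_left_kernel regS archS.
have lidK := left_kernel_left_ideal (power_absorbing_nonempty powK).
have idK : ideal left_kernel by split=> //; apply: left_kernel_right_ideal.
exists (left_ideal_subsemigroup lidK); split=> //.
- exact: left_kernel_left_simple.
- exact: ideal_pi_regular.
Qed.

End LeftKernel.

Theorem theorem2p3 (d : Order.disp_t) (S : orderedSemigroupType d) :
  [<-> (* 1 *) left_pi_t_simple S;
       (* 2 *) pi_regular S /\ has_Lstar_unique_ordered_idempotent S;
       (* 3 *) pi_regular S /\ (forall a b : S, Lstar a b);
       (* 4 *) forall a b : S, exists2 m, (0 < m)%N &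
                 downset [set a ^^ m * s * b | s in setT] (a ^^ m);
       (* 5 *) forall a b : S, exists2 m, (0 < m)%N &
                 forall n, (0 < n)%N ->
                   downset [set a ^^ m * s * b ^^ n | s in setT] (a ^^ m);
       (* 6 *) forall a b : S, exists2 m, (0 < m)%N &
                 downset [set a ^^ m * s * b ^^ m | s in setT] (a ^^ m);
       (* 7 *) pi_regular S /\ l_archimedean S;
       (* 8 *) exists K : subsemigroup S,
                 [/\ left_simple (subsg_osg K), pi_regular (subsg_osg K)
                   & nil_extension (subsg_set K)]].
Proof.
tfae.
- move=> [H [simpleH regH powH]].
  have regS := power_absorbing_pi_regular powH regH; split=> //.
  have archS := power_absorbing_l_archimedean powH simpleH.
  apply: Lstar_has_Lstar_unique_ordered_idempotent => //.
  exact: l_archimedean_Lstar.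
- move=> [regS uniqS]; split=> //.
  exact: has_Lstar_unique_ordered_idempotent_Lstar.
- by move=> [_ LS] a b; apply: Lstar_sandwich.
- move=> absS a b; have [m m_gt0 am] := absS a b; exists m => // n _.
  exact: l_archimedean_sandwich (sandwich_l_archimedean absS) am.
- by move=> absS a b; have [m m_gt0 am] := absS a b; exists m => //; apply: am.
- move=> absS; split=> [a|]; first exact: (absS a a).
  apply: sandwich_l_archimedean => a b; have [m m_gt0 am] := absS a b.
  by exists m => //; apply: sandwich_spow am.
- by move=> [regS archS]; apply: l_archimedean_nil_extension.
- by move=> [K [simpleK regK [_ powK]]]; exists K.
Qed.
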